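(* Let $G$ be a group hyperbolic relative to a collection of subgroups $\{H_\lambda\}_{\lambda\in\Lambda}$. If a subgroup $Q\le G$ is hyperbolically embedded into $G$, then $Q$ is a hyperbolic group.
   Context: Let $G$ be a group and $\{H_\lambda\}_{\lambda\in\Lambda}$ a collection (indexed family, $\Lambda$ arbitrary, possibly infinite) of subgroups of $G$; $G$ and the $H_\lambda$ need not be finitely generated. A symmetric subset $X=X^{-1}\subseteq G$ is a relative generating set of $G$ with respect to $\{H_\lambda\}_{\lambda\in\Lambda}$ if $X\cup\bigcup_{\lambda}H_\lambda$ generates $G$. Then $G$ is a quotient of $F=(\ast_{\lambda\in\Lambda}H_\lambda)\ast F(X)$, where $F(X)$ is the free group with basis $X$. If $X$ is finite and the kernel of $F\to G$ is the normal closure in $F$ of a finite set $\mathcal R$, then $\langle X, H_\lambda,\lambda\in\Lambda\mid R=1, R\in\mathcal R\rangle$ is a finite relative presentation of $G$, and $G$ is called finitely presented relative to $\{H_\lambda\}_{\lambda\in\Lambda}$. Put $\mathcal H=\bigsqcup_{\lambda\in\Lambda}(H_\lambda\setminus\{1\})$. For a word $W$ in the alphabet $X\cup\mathcal H$ representing $1$ in $G$, $Area^{rel}(W)$ is the smallest $k$ such that $W=_F\prod_{i=1}^k f_i^{-1}R_if_i$ with $f_i\in F$ and $R_i\in\mathcal R\cup\mathcal R^{-1}$. The relative Dehn function $\delta^{rel}(n)$ is the supremum (possibly $\infty$) of $Area^{rel}(W)$ over all words $W$ in $X\cup\mathcal H$ of length at most $n$ representing $1$ in $G$. $G$ is hyperbolic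 relative to $\{H_\lambda\}_{\lambda\in\Lambda}$ if it has a finite relative presentation whose relative Dehn function is linear, i.e. finite-valued and bounded above by $Cn$ for some constant $C$. A subgroup $Q\le G$ is hyperbolically embedded into $G$ if $G$ is hyperbolic relative to $\{H_\lambda\}_{\lambda\in\Lambda}\cup\{Q\}$, where $Q$ is adjoined as a new member of the indexed family (even if it equals some $H_\lambda$). A group is hyperbolic if it is finitely generated and its Cayley graph with respect to some finite generating set is a (Gromov) hyperbolic metric space. *)

(* Defs.v *)
From HB Require Import structures.
From mathcomp Require Import all_boot all_order all_algebra.
From mathcomp Require Import boolp classical_sets cardinality reals ereal.
From mathcomp Require Import Rstruct.

Set Implicit Arguments.
Unset Strict Implicit.
Unset Printing Implicit Defensive.

Import Order.TTheory GRing.Theory Num.Theory.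

Local Open Scope classical_set_scope.
Local Open Scope group_scope.

Notation Real := Rdefinitions.R.

(* Subgroups of G are elements of [groupClosed G]. These are boolean
   predicates, but the classical axioms of [boolp] turn any subset of G closed
   under the group operations into one. *)
Section SubgroupType.
Variables (G : groupType) (K : groupClosed G).

Record subgroup_type : Type :=
  SubgroupElement { subgroup_val : G; _ : subgroup_val \in K }.

HB.instance Definition _ := [isSub for subgroup_val].
HB.instance Definition _ := [Choice of subgroup_type by <:].

Lemma subgroup_type_closed : group_closed (fun x : G => x \in K).
Proof. by split; [apply: gpred1|apply: gpredF]. Qed.

HB.instance Definition _ :=
  SubChoice_isSubGroup.Build G (fun x : G => x \in K) subgroup_type
    subgroup_type_closed.

End SubgroupType.

Section GeneratedSubgroups.
Variable G : groupType.

Definition is_subgroup (A : set G) : Prop :=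
  A 1 /\ forall x y, A x -> A y -> A (x / y).

Definition is_normal_subgroup (A : set G) : Prop :=
  is_subgroup A /\ forall x y, A x -> A (x ^ y).

Definition generated_subgroup (A : set G) : set G := smallest is_subgroup A.

Definition normal_closure (A : set G) : set G := smallest is_normal_subgroup A.

End GeneratedSubgroups.

(* The free product of the groups K i (i : I) and of the free group with basis
   X: words in the letters x, x^-1 (x : X) and k (k : K i), modulo the least
   congruence containing the defining relations. *)
Section FreeProduct.
Variables (X : Type) (I : Type) (K : I -> groupType).

(* [BasisLetter x true] stands for x, [BasisLetter x false] for x^-1. *)
Inductive fp_letter : Type :=
  | BasisLetter of X & bool
  | FactorLetter (i : I) of K i.

HB.instance Definition _ := gen_eqMixin fp_letter.
HB.instance Definition _ := gen_choiceMixin fp_letter.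

Inductive fp_relation : seq fp_letter -> seq fp_letter -> Prop :=
  | fp_cancel x b : fp_relation [:: BasisLetter x b; BasisLetter x (~~ b)] [::]
  | fp_factor_mul i (h k : K i) :
      fp_relation [:: FactorLetter h; FactorLetter k] [:: FactorLetter (h * k)]
  | fp_factor_one i : fp_relation [:: FactorLetter (1 : K i)] [::].

Inductive fp_congruence : seq fp_letter -> seq fp_letter -> Prop :=
  | fp_base u v p s : fp_relation u v -> fp_congruence (p ++ u ++ s) (p ++ v ++ s)
  | fp_refl u : fp_congruence u u
  | fp_sym u v : fp_congruence u v -> fp_congruence v u
  | fp_trans u v w :
      fp_congruence u v -> fp_congruence v w -> fp_congruence u w.

Definition fp_congruenceb : rel (seq fp_letter) :=
  fun u v => `[< fp_congruence u v >].

Lemma fp_congruenceb_refl : reflexive fp_congruenceb.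
Proof. by move=> u; apply/asboolP/fp_refl. Qed.

Lemma fp_congruenceb_sym : symmetric fp_congruenceb.
Proof. by move=> u v; apply/asboolP/asboolP; exact: fp_sym. Qed.

Lemma fp_congruenceb_trans : transitive fp_congruenceb.
Proof.
by move=> v u w /asboolP uv /asboolP vw; apply/asboolP; exact: fp_trans vw.
Qed.

Canonical fp_congruence_equiv :=
  EquivRel fp_congruenceb fp_congruenceb_refl fp_congruenceb_sym
    fp_congruenceb_trans.

Definition free_product : Type := {eq_quot fp_congruenceb}%qT.

HB.instance Definition _ := Choice.on free_product.
HB.instance Definition _ := EqQuotient.on free_product.

Definition fp_of_word (w : seq fp_letter) : free_product :=
  (\pi_free_product w)%qT.

Lemma fp_of_wordP u v : fp_of_word u = fp_of_word v <-> fp_congruence u v.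
Proof.
rewrite /fp_of_word; split.
  by move/eqmodP => /asboolP.
by move=> uv; apply/eqmodP; apply/asboolP.
Qed.

Lemma fp_reprK a : fp_of_word (repr a) = a.
Proof. exact: reprK. Qed.

Lemma fp_repr_word w : fp_congruence (repr (fp_of_word w)) w.
Proof. by apply/fp_of_wordP; rewrite fp_reprK. Qed.

Lemma fp_congruence_ctx p s u v :
  fp_congruence u v -> fp_congruence (p ++ u ++ s) (p ++ v ++ s).
Proof.
elim=> {u v} [u v p' s' uv|u|u v _ IH|u v w _ IH1 _ IH2].
- have := fp_base (p ++ p') (s' ++ s) uv.
  by rewrite -!catA.
- exact: fp_refl.
- exact: fp_sym.
- exact: fp_trans IH2.
Qed.

Lemma fp_congruence_cat u u' v v' :
  fp_congruence u u' -> fp_congruence v v' ->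
  fp_congruence (u ++ v) (u' ++ v').
Proof.
move=> uu' vv'; apply: (@fp_trans _ (u' ++ v)).
  exact: (fp_congruence_ctx [::] v uu').
by have := fp_congruence_ctx u' [::] vv'; rewrite !cats0.
Qed.

Definition fp_inv_letter (l : fp_letter) : fp_letter :=
  match l with
  | BasisLetter x b => BasisLetter x (~~ b)
  | FactorLetter i k => FactorLetter k^-1
  end.

Definition fp_inv_word (w : seq fp_letter) : seq fp_letter :=
  rev (map fp_inv_letter w).

Lemma fp_letter_mulV l : fp_congruence [:: l; fp_inv_letter l] [::].
Proof.
case: l => [x b|i k] /=.
  exact: (fp_base [::] [::] (fp_cancel x b)).
apply: (fp_trans (fp_base [::] [::] (fp_factor_mul k k^-1))).
by rewrite mulgV; exact: (fp_base [::] [::] (fp_factor_one i)).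
Qed.

Lemma fp_inv_letterK : involutive fp_inv_letter.
Proof. by case=> [x b|i k] /=; rewrite ?negbK ?invgK. Qed.

Lemma fp_inv_wordK : involutive fp_inv_word.
Proof.
move=> w; rewrite /fp_inv_word map_rev revK -map_comp map_id_in// => l _ /=.
exact: fp_inv_letterK.
Qed.

Lemma fp_word_mulV w : fp_congruence (w ++ fp_inv_word w) [::].
Proof.
elim: w => [|l w IH]; first exact: fp_refl.
rewrite /fp_inv_word /= rev_cons -cats1 -/(fp_inv_word w) catA.
apply: fp_trans (fp_letter_mulV l).
exact: (fp_congruence_ctx [:: l] [:: fp_inv_letter l] IH).
Qed.

Lemma fp_word_Vmul w : fp_congruence (fp_inv_word w ++ w) [::].
Proof. by have := fp_word_mulV (fp_inv_word w); rewrite fp_inv_wordK. Qed.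

Definition fp_one : free_product := fp_of_word [::].
Definition fp_mul (a b : free_product) : free_product :=
  fp_of_word (repr a ++ repr b).
Definition fp_inv (a : free_product) : free_product :=
  fp_of_word (fp_inv_word (repr a)).

Lemma fp_mulE u v : fp_mul (fp_of_word u) (fp_of_word v) = fp_of_word (u ++ v).
Proof. by apply/fp_of_wordP/fp_congruence_cat; exact: fp_repr_word. Qed.

Lemma fp_mulA : associative fp_mul.
Proof.
move=> a b c; rewrite -(fp_reprK a) -(fp_reprK b) -(fp_reprK c).
by rewrite !fp_mulE catA.
Qed.

Lemma fp_mul1 : left_id fp_one fp_mul.
Proof. by move=> a; rewrite -(fp_reprK a) fp_mulE. Qed.

Lemma fp_mul1r : right_id fp_one fp_mul.
Proof. by move=> a; rewrite -(fp_reprK a) fp_mulE cats0. Qed.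

Lemma fp_mulV : left_inverse fp_one fp_inv fp_mul.
Proof.
move=> a; rewrite -{2}(fp_reprK a) fp_mulE.
by apply/fp_of_wordP; exact: fp_word_Vmul.
Qed.

Lemma fp_mulVr : right_inverse fp_one fp_inv fp_mul.
Proof.
move=> a; rewrite -{1}(fp_reprK a) fp_mulE.
by apply/fp_of_wordP; exact: fp_word_mulV.
Qed.

HB.instance Definition _ :=
  isGroup.Build free_product fp_mulA fp_mul1 fp_mul1r fp_mulV fp_mulVr.

Definition fp_basis (x : X) : free_product :=
  fp_of_word [:: BasisLetter x true].

Definition fp_factor (i : I) (k : K i) : free_product :=
  fp_of_word [:: FactorLetter k].

(* The homomorphism to a group G induced by a map f and homomorphisms g i. *)
Section Lift.
Variables (G : groupType) (f : X -> G) (g : forall i, K i -> G).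

Definition fp_letter_val (l : fp_letter) : G :=
  match l with
  | BasisLetter x b => if b then f x else (f x)^-1
  | FactorLetter i k => g k
  end.

Definition fp_word_val (w : seq fp_letter) : G :=
  \prod_(l <- w) fp_letter_val l.

Definition fp_lift (a : free_product) : G := fp_word_val (repr a).

Hypothesis gM : forall i, {morph @g i : h k / h * k}.

Lemma fp_word_val_congruence u v :
  fp_congruence u v -> fp_word_val u = fp_word_val v.
Proof.
have g1 i : g (1 : K i) = 1.
  by apply: (@mulgI _ (g (1 : K i))); rewrite -gM !mulg1.
elim=> {u v} [u v p s uv|//|u v _ ->//|u v w _ -> _ ->//].
rewrite /fp_word_val !big_cat /=; congr (_ * (_ * _)).
case: uv => [x b|i h k|i]; rewrite !big_cons !big_nil /= ?mulg1 ?gM ?g1 //.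
by case: b; rewrite ?mulgV ?mulVg.
Qed.

Lemma fp_lift_word w : fp_lift (fp_of_word w) = fp_word_val w.
Proof. exact/fp_word_val_congruence/fp_repr_word. Qed.

Lemma fp_liftM : {morph fp_lift : a b / a * b}.
Proof.
move=> a b; rewrite -(fp_reprK a) -(fp_reprK b).
by rewrite [X in fp_lift X]fp_mulE !fp_lift_word /fp_word_val big_cat.
Qed.

Lemma fp_lift_basis x : fp_lift (fp_basis x) = f x.
Proof. by rewrite fp_lift_word /fp_word_val big_seq1. Qed.

Lemma fp_lift_factor i (k : K i) : fp_lift (fp_factor k) = g k.
Proof. by rewrite fp_lift_word /fp_word_val big_seq1. Qed.

End Lift.

End FreeProduct.

Section RelativePresentations.
Variables (G : groupType) (I : Type) (H : I -> groupClosed G).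

Definition peripheral (i : I) : groupType := subgroup_type (H i).

Definition relative_generating_set (X : set G) : Prop :=
  [set x^-1 | x in X] = X /\
  generated_subgroup (X `|` \bigcup_i [set` H i]) = setT.

Section RelativeDehnFunction.
Variable X : set G.

(* F(X) has all of X as a basis: although X = X^-1, the basis element attached
   to x^-1 is not the inverse of the one attached to x. *)
Definition rel_free : groupType :=
  free_product X peripheral.

Definition rel_free_to_group : rel_free -> G :=
  fp_lift (fun x : X => val x) (fun i (h : peripheral i) => subgroup_val h).

Lemma rel_free_to_groupM : {morph rel_free_to_group : a b / a * b}.
Proof. by apply: fp_liftM => i h k; exact: (valM (h : subgroup_type (H i))). Qed.

Inductive rel_letter : Type :=
  | GenLetter of X
  | PeripheralLetter (i : I) (h : peripheral i) of h != 1.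

Definition rel_letter_val (l : rel_letter) : rel_free :=
  match l with
  | GenLetter x => fp_basis peripheral x
  | PeripheralLetter i h _ => fp_factor X h
  end.

Definition rel_word_val (W : seq rel_letter) : rel_free :=
  \prod_(l <- W) rel_letter_val l.

Variable rels : set rel_free.

Definition finite_relative_presentation : Prop :=
  [/\ relative_generating_set X, finite_set X, finite_set rels &
      [set a | rel_free_to_group a = 1] = normal_closure rels].

(* The pair (r, f) contributes the factor r ^ f = f^-1 * r * f. *)
Definition product_of_conjugates (k : nat) (a : rel_free) : Prop :=
  exists s : seq (rel_free * rel_free),
    [/\ size s = k,
        forall p, p \in s -> rels p.1 \/ rels p.1^-1 &
        a = \prod_(p <- s) p.1 ^ p.2].

Definition relative_area (W : seq rel_letter) : \bar Real :=
  ereal_inf [set (k%:R)%:E |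
    k in [set k | product_of_conjugates k (rel_word_val W)]].

Definition relative_dehn (n : nat) : \bar Real :=
  ereal_sup [set relative_area W |
    W in [set W | (size W <= n)%N /\ rel_free_to_group (rel_word_val W) = 1]].

End RelativeDehnFunction.

Definition relatively_hyperbolic : Prop :=
  exists (X : set G) (rels : set (rel_free X)),
    finite_relative_presentation rels /\
    exists C : Real, forall n, (relative_dehn rels n <= (C * n%:R)%R%:E)%E.

End RelativePresentations.

Definition adjoin_subgroup (G : groupType) (I : Type) (H : I -> groupClosed G)
    (Q : groupClosed G) : option I -> groupClosed G :=
  fun o => if o is Some i then H i else Q.

Definition hyperbolically_embedded (G : groupType) (I : Type)
    (H : I -> groupClosed G) (Q : groupClosed G) : Prop :=
  relatively_hyperbolic (adjoin_subgroup H Q).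

(* Gromov's definition of a hyperbolic metric space, for a distance d on T. *)
Section GromovHyperbolic.
Local Open Scope ring_scope.
Variables (T : Type) (d : T -> T -> Real).

Definition gromov_product (w x y : T) : Real := (d x w + d y w - d x y) / 2%:R.

Definition gromov_hyperbolic : Prop :=
  exists delta : Real, forall w x y z,
    Num.min (gromov_product w x z) (gromov_product w z y) - delta
      <= gromov_product w x y.

End GromovHyperbolic.

(* The Cayley graph as a metric 1-complex: vertex set G and, for each g in G
   and s in S, an edge of length 1 from g to g * s. *)
Section CayleyGraph.
Variables (G : groupType) (S : set G).

Definition cayley_adjacent : rel G :=
  fun g h => `[< exists2 s, S s & h = g * s \/ g = h * s >].

Definition cayley_vertex_dist (g h : G) : Real :=
  inf [set ((size p)%:R)%R |
    p in [set p | path cayley_adjacent g p /\ last g p = h]].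

(* [EdgePoint g s t01] is the point at distance t from g on the edge (g, s). *)
Inductive cayley_point : Type :=
  | VertexPoint of G
  | EdgePoint (g : G) (s : S) (t : Real) of (0 < t < 1)%R.

(* The endpoints of the closed cell of p, with their distances to p along it. *)
Definition cell_ends (p : cayley_point) : seq (G * Real) :=
  match p with
  | VertexPoint g => [:: (g, 0%R)]
  | EdgePoint g s t _ => [:: (g, t); (g * val s, (1 - t)%R)]
  end.

Definition same_edge_lengths (p q : cayley_point) : set Real :=
  match p, q with
  | EdgePoint g s t _, EdgePoint g' s' t' _ =>
      [set r | [/\ g = g', s = s' & r = `|t - t'|%R]]
  | _, _ => set0
  end.

(* The path metric: a shortest path either stays inside one edge or passes
   through an endpoint of the cell of p and an endpoint of the cell of q. *)
Definition cayley_dist (p q : cayley_point) : Real :=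
  inf (same_edge_lengths p q `|`
    [set r | exists a b, [/\ a \in cell_ends p, b \in cell_ends q &
               r = (a.2 + cayley_vertex_dist a.1 b.1 + b.2)%R]]).

End CayleyGraph.

Definition hyperbolic_group (G : groupType) : Prop :=
  exists S : set G,
    [/\ finite_set S, generated_subgroup S = setT &
        gromov_hyperbolic (@cayley_dist G S)].

(* Main.v *)
Require Import Defs.
From mathcomp Require Import all_boot all_order all_algebra.
From mathcomp Require Import boolp classical_sets cardinality reals ereal.
From mathcomp Require Import Rstruct zify ring lra.

(** Write [d_Y] for a word metric on [Q] and [d] for the word metric of [G] with
    respect to [X] and the subgroups [H i].  The whole proof tests relative area
    against discrete 1-forms: a sum over the letters of a word, with values in
    [int], that is invariant in the free product and bounded on each relator is
    bounded on a word by a multiple of its relative area.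

    For the presentation relative to [H] and [Q], take the increments along
    [Q]-letters of the (truncated) word length with respect to the finite set [Y]
    of all [Q]-letters in the relators.  If [q] in [Q] is a word of length [n] in
    [X] and [H], closing this word up with the letter [q^-1] shows that
    [d_Y 1 q] is linear in [n]: [Q] is finitely generated and undistorted.

    For the presentation relative to [H], take the form [f dg], where [f] and [g]
    are Lipschitz extensions to [G] of 1-Lipschitz functions on [Q], integrated
    inside a coset of [H i] through a fixed base point.  Hence the image of any
    loop of [Q] under [(f, g)] encloses an area at most linear in its length.

    Such a linear bound forces hyperbolicity.  If a loop consists of a geodesic
    through [p] and a path at distance at least [rho] from [p], then
    [f = rho - d_Y(p, -)] and the coordinate [g] along the geodesic give
    [rho ^ 2 <= K * length].  Localising this gives the stability of
    3-quasigeodesics, and the projection of a point to a geodesic then yields the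
    four-point condition. *)

Set Implicit Arguments.
Unset Strict Implicit.
Unset Printing Implicit Defensive.

Import Order.TTheory GRing.Theory Num.Theory.

(** * Linear area in the plane implies the four-point condition *)

Section CoarseGeometry.
Local Open Scope ring_scope.

(** Twice the trapezoidal rule for [f dg] on one step, so that values stay in [int]. Summed around a
    loop it gives twice the signed area enclosed by the image under [(f, g)]. *)
Definition area_form (T : Type) (f g : T -> int) (a b : T) : int :=
  (f a + f b) * (g b - g a).

Fixpoint area_along (T : Type) (f g : T -> int) (x : T) (s : seq T) : int :=
  if s is y :: s' then area_form f g x y + area_along f g y s' else 0.

Lemma area_along_cat (T : Type) (f g : T -> int) x s t :
  area_along f g x (s ++ t) = area_along f g x s + area_along f g (last x s) t.
Proof. by elim: s x => [|y s IH] x /=; rewrite ?add0r // IH addrA. Qed.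

Local Open Scope nat_scope.

Variables (T : Type) (d : T -> T -> nat).

Definition lipschitz1 (f : T -> nat) : Prop := forall a b, f a <= f b + d a b.

Definition linear_area (K : nat) : Prop :=
  forall f g : T -> nat, lipschitz1 f -> lipschitz1 g ->
  forall x s, path (fun a b => d a b <= 1) x s -> last x s = x ->
  (`|area_along (Posz \o f) (Posz \o g) x s|%N <= K * (size s).+1)%N.

Definition geodesic_on (r : nat -> T) (n : nat) : Prop :=
  forall i j, i <= j <= n -> d (r i) (r j) = j - i.

Hypothesis d_refl : forall x, d x x = 0.
Hypothesis d_sym : forall x y, d x y = d y x.
Hypothesis d_triangle : forall x y z, d x z <= d x y + d y z.
Hypothesis d_geodesic : forall x y,
  exists2 r, geodesic_on r (d x y) & r 0 = x /\ r (d x y) = y.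

(** * Walks, and detours around a point of a geodesic *)

Inductive walk (P : T -> Prop) : nat -> T -> T -> Prop :=
  | walk_nil x : P x -> walk P 0 x x
  | walk_cons n x y z :
      P x -> d x y <= 1 -> walk P n y z -> walk P n.+1 x z.

Lemma walk_cat P m n x y z :
  walk P m x y -> walk P n y z -> walk P (m + n) x z.
Proof.
elim=> {m x y} // m x y y' Px xy _ IH /IH; rewrite addSn.
exact: walk_cons.
Qed.

Lemma walk_start P n x y : walk P n x y -> P x.
Proof. by case. Qed.

Lemma walk_sym P n x y : walk P n x y -> walk P n y x.
Proof.
elim=> {n x y} [x Px|n x y z Px xy wyz IH]; first exact: walk_nil.
rewrite -addn1; apply: walk_cat IH _.
apply: walk_cons (walk_start wyz) _ (walk_nil Px).
by rewrite d_sym.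
Qed.

Lemma walk_along P (r : nat -> T) a n :
    (forall i, a <= i <= a + n -> P (r i)) ->
    (forall i, a <= i < a + n -> d (r i) (r i.+1) <= 1) ->
  walk P n (r a) (r (a + n)).
Proof.
elim: n => [|n IH] Pr r1; first by rewrite addn0; apply: walk_nil (Pr _ _); lia.
rewrite -[n.+1]addn1 addnA; apply: (walk_cat (IH _ _)) => [i ?|i ?|].
- by apply: Pr; lia.
- by apply: r1; lia.
apply: walk_cons (walk_nil _); [apply: Pr; lia| |apply: Pr; lia].
by rewrite addn1; apply: r1; lia.
Qed.

Lemma walk_seq P n x y : walk P n x y ->
  exists s, [/\ path (fun a b => d a b <= 1) x s, last x s = y, size s = n &
    forall f g, (forall z, P z -> f z = 0%R) -> area_along f g x s = 0%R].
Proof.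
elim=> {n x y} [x Px|n x y z Px xy wyz [s [sp sl ss sa]]]; first by exists [::].
exists (y :: s); split => //=; [by rewrite xy|by rewrite ss|].
move=> f g fP; rewrite sa // /area_form !fP ?addr0 ?mul0r //.
exact: walk_start wyz.
Qed.

Definition steps (r : nat -> T) a n : seq T := [seq r i | i <- iota a.+1 n].

Lemma last_steps r a n x : x = r a -> last x (steps r a n) = r (a + n).
Proof.
move=> ->; elim: n a => [|n IH] a /=; first by rewrite addn0.
by rewrite -addSnnS; apply: IH.
Qed.

Lemma path_steps r a n :
  (forall i, a <= i < a + n -> d (r i) (r i.+1) <= 1) ->
  path (fun a b => d a b <= 1) (r a) (steps r a n).
Proof.
elim: n a => //= n IH a r1; apply/andP; split; first by apply: r1; lia.
by apply: IH => i ?; apply: r1; lia.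
Qed.

Lemma stepsD r a m n : steps r a (m + n) = steps r a m ++ steps r (a + m) n.
Proof. by rewrite /steps iotaD map_cat addSn. Qed.

(* Stokes for the bump [f = rho - d(p, -)] and the coordinate [g] of the
   geodesic: [f dg] vanishes on the detour and integrates to at least [rho^2]
   on the geodesic. *)
Lemma detour_length K (r : nat -> T) L i rho n :
  linear_area K -> geodesic_on r L -> rho <= i -> i + rho <= L ->
  walk (fun z => rho <= d (r i) z) n (r L) (r 0) ->
  rho * rho <= K * (L + n).+1.
Proof.
move=> Karea geo ri riL /walk_seq [s [sp sl ss sa]].
pose f z := rho - d (r i) z; pose g z := d (r 0) z.
have fL : lipschitz1 f.
  by move=> a b; rewrite /f; have := d_triangle (r i) a b; lia.
have gL : lipschitz1 g.
  move=> a b; rewrite /g; have := d_triangle (r 0) b a.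
  by rewrite (d_sym b); lia.
have r1 j : j < L -> d (r j) (r j.+1) <= 1 by move=> jL; rewrite geo; lia.
have gE j : j <= L -> g (r j) = j by move=> jL; rewrite /g geo; lia.
pose A a m := area_along (Posz \o f) (Posz \o g) (r a) (steps r a m).
have AD a m1 m2 : A a (m1 + m2) = (A a m1 + A (a + m1)%N m2)%R.
  by rewrite /A stepsD area_along_cat last_steps.
have A1 j : j < L -> A j 1 = (f (r j) + f (r j.+1))%:Z.
  by move=> jL; rewrite /A /= /area_form /= !gE; lia.
have A0 a : A a 0 = 0%R by [].
have AE : area_along (Posz \o f) (Posz \o g) (r 0) (steps r 0 L) = A 0 L by [].
clearbody A.
have A_ge0 a m : a + m <= L -> (0 <= A a m)%R.
  elim: m => [|m IH] amL; first by rewrite A0.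
  rewrite -addn1 AD A1; last by lia.
  by apply: addr_ge0 => //; apply: IH; lia.
(* Only the half of the bump past [r i] is computed: the odd numbers [2 (rho - k) - 1] for [k < m]
   add up to [m (2 rho - m)], hence to [rho ^ 2] at [m = rho]. The rest of the geodesic contributes
   a nonnegative amount by [A_ge0]. *)
have Abump m : m <= rho -> (A i m = m%:Z * (2%:Z * rho%:Z - m%:Z))%R.
  elim: m => [|m IH] mr; first by rewrite A0 mul0r.
  rewrite -addn1 AD IH 1?A1; [|lia|lia].
  have -> : f (r (i + m)) = rho - m by rewrite /f geo; lia.
  have -> : f (r (i + m).+1) = rho - m.+1 by rewrite /f geo; lia.
  nia.
have := Karea _ _ fL gL (r 0) (steps r 0 L ++ s).
rewrite cat_path last_cat last_steps // add0n sp andbT area_along_cat.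
rewrite last_steps //.
rewrite add0n sa => [|z /= ?]; last by congr Posz; rewrite /f; lia.
rewrite addr0 size_cat size_map size_iota ss AE => /(_ _ sl) Kb.
have {Kb} : (`|A 0 L|%N <= K * (L + n).+1)%N.
  by apply: Kb; apply: path_steps => j ?; apply: r1; lia.
have -> : L = i + (rho + (L - i - rho)) by lia.
rewrite AD AD !add0n Abump //; set q := K * _.
by have := A_ge0 0 i; have := A_ge0 (i + rho) (L - i - rho); nia.
Qed.

Lemma walk_geodesic P x y : (forall z, d x z <= d x y -> P z) ->
  walk P (d x y) x y.
Proof.
have [r geo [r0 rd]] := d_geodesic x y.
move: (d x y) geo rd => n geo rd Pxy.
rewrite -{1}r0 -{1}rd -[n in r n]add0n; apply: walk_along => i ?.
  by apply: Pxy; rewrite -r0 geo; lia.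
by rewrite geo; lia.
Qed.

(** * Stability of 3-quasigeodesics *)

Definition quasigeodesic3 (c : nat -> T) (N : nat) : Prop :=
  forall i j, i <= j <= N -> d (c i) (c j) <= j - i <= 3 * d (c i) (c j).

(** At a point of [S] farthest from [c], at distance [rho], a detour goes along [c], joined to [S]
    about [2 * rho] away on both sides. Its length is linear in [rho], so [detour_length] bounds
    [rho]. *)
Lemma geodesic_near_quasigeodesic K S n c N :
  linear_area K -> geodesic_on S n -> quasigeodesic3 c N ->
  S 0 = c 0 -> S n = c N ->
  forall i, i <= n -> exists2 j, j <= N & d (S i) (c j) <= 25 * K.
Proof.
move=> Karea geo quasi S0 Sn.
pose near rho :=
  `[< forall i, i <= n -> exists2 j, j <= N & d (S i) (c j) <= rho >].
have near_ex : exists rho, near rho.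
  exists n; apply/asboolP => i iN; exists 0 => //.
  by rewrite -S0 d_sym geo; lia.
(* The least such [rho] is the largest distance from a point of [S] to [c]. *)
have [rho /asboolP near_rho rho_min] := ex_minnP near_ex.
suff rhoK : rho <= 25 * K.
  by move=> i /near_rho [j jN ij]; exists j => //; exact: leq_trans rhoK.
rewrite leqNgt; apply/negP => rhoK.
have [i iN far] : exists2 i, i <= n & forall j, j <= N -> rho <= d (S i) (c j).
  apply: contrapT => no_far.
  suff /rho_min : near rho.-1 by lia.
  apply/asboolP => i iN; apply: contrapT => no_near.
  apply: no_far; exists i => // j jN; rewrite leqNgt; apply/negP => ij.
  by apply: no_near; exists j => //; lia.
have iS : rho <= i by have := far 0 isT; rewrite -S0 d_sym geo; lia.
have Si : rho <= n - i by have := far N (leqnn _); rewrite -Sn geo; lia.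
pose P z := rho <= d (S i) z.
pose connected k := exists2 j, j <= N &
  exists2 m, m <= rho & walk P m (S k) (c j) /\ d (S k) (c j) <= rho.
(* From a point at distance [2 * rho] from [S i], a geodesic of length at most [rho] stays outside
   the open [rho]-ball. The ends of [S] already lie on [c]. *)
have conn k : k <= n -> (d (S i) (S k) = 2 * rho \/ k = 0 \/ k = n) ->
    connected k.
  move=> kn [ik|[->|->]].
  - have [j jN kj] := near_rho k kn.
    exists j => //; exists (d (S k) (c j)) => //; split=> //.
    apply: walk_geodesic => z kz; rewrite /P.
    by have := d_triangle (S i) z (S k); rewrite (d_sym z); lia.
  - exists 0 => //; exists 0 => //; rewrite S0 d_refl; split=> //.
    by apply: walk_nil; exact: far.
  - exists N => //; exists 0 => //; rewrite Sn d_refl; split=> //.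
    by apply: walk_nil; exact: far.
(* Truncated subtraction and [minn] stop at the ends of [S] when these are closer than [2 * rho]. *)
pose a := i - 2 * rho; pose b := minn n (i + 2 * rho).
have [j1 j1N [m1 m1r [w1 d1]]] : connected a.
  apply: conn; first by rewrite /a; lia.
  by rewrite d_sym geo /a; lia.
have [j2 j2N [m2 m2r [w2 d2]]] : connected b.
  apply: conn; first by rewrite /b; lia.
  by rewrite geo /b; lia.
have dab : d (S a) (S b) = b - a by rewrite geo // /a /b; lia.
have d12 : d (c j1) (c j2) <= 6 * rho.
  have := d_triangle (c j1) (S a) (c j2); have := d_triangle (S a) (S b) (c j2).
  have : b - a <= 4 * rho by rewrite /a /b; lia.
  by rewrite (d_sym (c j1) (S a)) dab; lia.
have [m m18 w12] : exists2 m, m <= 18 * rho & walk P m (c j1) (c j2).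
  have wc k l : k <= l <= N -> walk P (l - k) (c k) (c l).
    move=> kl; rewrite -{2}(@subnKC k l); last by lia.
    apply: walk_along => q ?; first by apply: far; lia.
    by have := @quasi q q.+1; lia.
  have [j12|j12] := leqP j1 j2.
    exists (j2 - j1); last by apply: wc; lia.
    by have := @quasi j1 j2; lia.
  exists (j1 - j2); last by apply: walk_sym; apply: wc; lia.
  by have := @quasi j2 j1; rewrite d_sym in d12; lia.
have geo' : geodesic_on (fun k => S (a + k)) (b - a).
  by move=> k l kl; rewrite geo; rewrite /a /b in kl *; lia.
have w : walk P (m2 + (m + m1)) (S (a + (b - a))) (S (a + 0)).
  have -> : a + (b - a) = b by rewrite /a /b; lia.
  rewrite addn0; apply: walk_cat w2 _.
  exact: walk_cat (walk_sym w12) (walk_sym w1).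
have := @detour_length K (fun k => S (a + k)) (b - a) (i - a) rho _ Karea geo'.
have -> : a + (i - a) = i by rewrite /a; lia.
move=> /(_ _ _ _ w) H.
have {}H : rho * rho <= K * (b - a + (m2 + (m + m1))).+1.
  by apply: H; rewrite /a /b; lia.
(* The geodesic piece takes [4 * rho], the connections [2 * rho], the part of [c] takes
   [3 * (6 * rho)], and the extra 1 is at most [rho]: in all [25 * rho]. *)
have : K * (b - a + (m2 + (m + m1))).+1 <= K * (25 * rho).
  by rewrite leq_mul2l; apply/orP; right; rewrite /a /b; lia.
nia.
Qed.

(** Connectedness of [S]: some [S i] is close both to a [c k] with [k <= j] and to a [c l] with
    [j <= l]. These are at most [50 * K + 1] apart, so [l - k <= 150 * K + 3]; another [25 * K]
    leads from [c k] to [S i]. *)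
Lemma quasigeodesic_near_geodesic K S n c N :
  linear_area K -> geodesic_on S n -> quasigeodesic3 c N ->
  S 0 = c 0 -> S n = c N ->
  forall j, j <= N -> exists2 i, i <= n & d (c j) (S i) <= 175 * K + 3.
Proof.
move=> Karea geo quasi S0 Sn j jN.
have near := geodesic_near_quasigeodesic Karea geo quasi S0 Sn.
have [jS|jS] := eqVneq j N.
  by exists n => //; rewrite jS -Sn d_refl.
pose before i := `[< i <= n /\ exists2 k, k <= j & d (S i) (c k) <= 25 * K >].
have before0 : exists i, before i.
  by exists 0; apply/asboolP; split=> //; exists 0; rewrite // S0 d_refl.
have before_le i : before i -> i <= n by move=> /asboolP[].
have [i /asboolP[i_n [k kj ik]] i_max] := ex_maxnP before0 before_le.
(* For the last such [i], the point of [c] near [S i.+1] lies past [j]; if [i = n], the end of [c]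
   serves. *)
have [l [lj lN dl]] : exists l,
    [/\ j <= l, l <= N & d (S i) (c l) <= 25 * K + 1].
  have [iE|i_lt] := eqVneq i n.
    by exists N; split=> //; rewrite iE Sn d_refl.
  have [|l lN il] := near i.+1; first by lia.
  exists l; split=> //.
    rewrite leqNgt; apply/negP => lj.
    suff /i_max : before i.+1 by lia.
    by apply/asboolP; split; [lia|exists l => //; lia].
  have := d_triangle (S i) (S i.+1) (c l); rewrite geo; lia.
exists i => //.
have dkl : d (c k) (c l) <= 50 * K + 1.
  by have := d_triangle (c k) (S i) (c l); rewrite (d_sym (c k) (S i)); lia.
have := @quasi k l; have := @quasi k j; have := d_triangle (c j) (c k) (S i).
by rewrite (d_sym (c j) (c k)) (d_sym (c k) (S i)); lia.
Qed.

(* [x, r i] followed by a geodesic from [r i] to its farther point [z] is a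
   3-quasigeodesic, because [r i] is the point of [x, r i] closest to [z]. *)
Lemma projection_near_side K r n z i : linear_area K ->
  geodesic_on r n -> i <= n -> (forall k, k <= n -> d z (r i) <= d z (r k)) ->
  forall j, j <= i -> exists y,
    d (r 0) y + d y z = d (r 0) z /\ d (r j) y <= 175 * K + 3.
Proof.
move=> Karea geo i_n proj j ji.
have [h hgeo [h0 hd]] := d_geodesic (r i) z.
have [S Sgeo [S0 Sd]] := d_geodesic (r 0) z.
set m := d (r i) z in hgeo hd.
pose c k := if k <= i then r k else h (k - i).
have cE k : i <= k -> c k = h (k - i).
  move=> ik; rewrite /c; case: leqP => // ki.
  by have -> : k = i by [lia]; rewrite subnn h0.
have quasi : quasigeodesic3 c (i + m).
  move=> k l kl; rewrite {1 3}/c; case: (leqP k i) => ki.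
    case: (leqP l i) => il.
      by rewrite /c il geo; lia.
    (* The point [y = h (l - i)] lies on a geodesic from [z] to its closest point [r i], so
       [d (r i) y <= d (r k) y]. Then [d (r k) (r i) <= 2 * d (r k) y], and the two pieces together
       have length at most [3 * d (r k) y]. *)
    rewrite cE; last by lia.
    have e1 : d (h (l - i)) z = m - (l - i) by rewrite -hd hgeo; lia.
    have e2 : d (r i) (h (l - i)) = l - i by rewrite -h0 hgeo; lia.
    have e3 : d (r k) (r i) = i - k by rewrite geo; lia.
    have := proj k _; rewrite !(d_sym z) -/m.
    have := d_triangle (r k) (h (l - i)) z.
    have := d_triangle (r k) (r i) (h (l - i)).
    have := d_triangle (r k) (h (l - i)) (r i).
    rewrite (d_sym (h _) (r i)); lia.
  by rewrite cE ?hgeo; lia.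
have [|||k kS jk] := quasigeodesic_near_geodesic Karea Sgeo quasi _ _ (j := j).
- by rewrite S0 /c.
- by rewrite Sd cE ?addKn ?hd //; lia.
- by lia.
exists (S k); split; last by move: jk; rewrite /c ji.
have e1 : d (r 0) (S k) = k by rewrite -S0 Sgeo; lia.
have e2 : d (S k) z = d (r 0) z - k by rewrite -{1}Sd Sgeo; lia.
by rewrite e1 e2; lia.
Qed.

(** * Projection to a geodesic and the four-point condition *)

Lemma geodesic_rev r n : geodesic_on r n -> geodesic_on (fun i => r (n - i)) n.
Proof. by move=> geo i j ij; rewrite d_sym geo; lia. Qed.

Lemma geodesic_projection r n z :
  exists2 i, i <= n & forall k, k <= n -> d z (r i) <= d z (r k).
Proof.
pose P m := `[< exists2 i, i <= n & d z (r i) = m >].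
have Pex : exists m, P m by exists (d z (r 0)); apply/asboolP; exists 0.
have [m /asboolP[i i_n <-] m_min] := ex_minnP Pex.
by exists i => // k kn; apply: m_min; apply/asboolP; exists k.
Qed.

(** Let [r i] and [r j] be the projections of [w] and [z] to a geodesic from [x] to [y]. If
    [i <= j], then [r i] is near geodesics from [x] to [z] and from [y] to [w]; adding the two
    approximate splittings at [r i] gives the first alternative. The case [j < i] exchanges [x] and
    [y]. *)
Lemma four_point K : linear_area K -> forall w x y z,
  d z w + d x y <= d y w + d x z + 6 * (175 * K + 3) \/
  d z w + d x y <= d x w + d z y + 6 * (175 * K + 3).
Proof.
move=> Karea w x y z; set C := 175 * K + 3.
have [r geo [r0 rn]] := d_geodesic x y; set n := d x y in geo rn *.
have [i i_n w_proj] := geodesic_projection r n w.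
have [j j_n z_proj] := geodesic_projection r n z.
have side u k : k <= n -> (forall l, l <= n -> d u (r k) <= d u (r l)) ->
    forall l, l <= k -> exists v, d x v + d v u = d x u /\ d (r l) v <= C.
  by rewrite -r0; exact: projection_near_side.
have side' u k : k <= n -> (forall l, l <= n -> d u (r k) <= d u (r l)) ->
    forall l, k <= l <= n -> exists v, d y v + d v u = d y u /\ d (r l) v <= C.
  move=> kn proj l lk.
  have := @projection_near_side K _ n u (n - k) Karea (geodesic_rev geo).
  move=> /(_ _ _ (n - l)) [|q qn||v]; [lia| |lia|].
    by rewrite subKn //; apply: proj; lia.
  by rewrite subn0 rn subKn; [exists v|lia].
have [a [xa ra]] := side w i i_n w_proj i (leqnn _).
have [b [yb rb]] := side' w i i_n w_proj i (introT andP (conj (leqnn _) i_n)).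
have xi : d x (r i) = i by rewrite -r0 geo; lia.
have yi : d (r i) y = n - i by rewrite -rn geo; lia.
have := d_triangle x a (r i); have := d_triangle y b (r i).
have := d_triangle (r i) a w; have := d_triangle (r i) b w.
rewrite (d_sym a (r i)) (d_sym b (r i)) (d_sym y (r i)) => *.
have [ij|ji] := leqP i j.
  left; have [c [xc rc]] := side z j j_n z_proj i ij.
  have := d_triangle x (r i) c; have := d_triangle z c w.
  have := d_triangle c (r i) w; have := d_triangle x c (r i).
  by rewrite (d_sym c (r i)) (d_sym z c); lia.
right; have [|c [yc rc]] := side' z j j_n z_proj i; first by lia.
have := d_triangle y (r i) c; have := d_triangle z c w.
have := d_triangle c (r i) w; have := d_triangle y c (r i).
by rewrite (d_sym c (r i)) (d_sym z c) (d_sym y (r i)) (d_sym z y); lia.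
Qed.

End CoarseGeometry.

(** * Integrals over words *)

Local Open Scope classical_set_scope.
Local Open Scope group_scope.

Section WordIntegral.
Variables (X I : Type) (K : I -> groupType) (G : groupType).
Variables (f : X -> G) (g : forall i, K i -> G).
Hypothesis gM : forall i, {morph @g i : h k / h * k}.
Variables (c : X -> G -> int) (u : I -> G -> int).

(** [c x a] is the value of the form on the edge from [a] to [a * f x]; an inverse letter runs
    backwards along the edge ending at [a]. On letters of [K i] the form is the differential of the
    potential [u i]. *)
Definition letter_integral (a : G) (l : fp_letter X K) : int :=
  match l with
  | BasisLetter x b => if b then c x a else (- c x (a * (f x)^-1)%g)%R
  | FactorLetter i k => (u i (a * g k)%g - u i a)%R
  end.

Fixpoint word_integral (a : G) (w : seq (fp_letter X K)) : int :=
  if w is l :: w' then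
    (letter_integral a l + word_integral (a * fp_letter_val f g l)%g w')%R
  else 0%R.

Lemma word_integral_cat a v w :
  word_integral a (v ++ w) =
    (word_integral a v + word_integral (a * fp_word_val f g v)%g w)%R.
Proof.
rewrite /fp_word_val; elim: v a => [|l v IH] a /=.
  by rewrite big_nil mulg1 add0r.
by rewrite IH big_cons addrA mulgA.
Qed.

(** Cancelling letters run along an edge and back, and the potentials telescope over products in a
    factor. Congruent words have the same value in [G], so the letters that follow start at the same
    point. *)
Lemma word_integral_congruence v w a :
  fp_congruence v w -> word_integral a v = word_integral a w.
Proof.
move=> vw; elim: vw a => {v w} [v w p s vw|//|v w _ IH|v w t _ IH1 _ IH2] a.
- have valE := fp_word_val_congruence f gM (fp_base [::] [::] vw).
  rewrite !cats0 !cat0s in valE.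
  rewrite !word_integral_cat valE; congr (_ + (_ + _))%R.
  move: (a * _) => {}a {valE p s}.
  case: vw => [x b|i h k|i] /=.
  + by case: b; rewrite /= ?mulgK ?mulgVK ?subrr ?addr0 ?addrN ?addNr.
  + by rewrite gM mulgA !addr0 [LHS]addrC subrKA.
  + have -> : g (1 : K i) = 1.
      by apply: (@mulgI _ (g (1 : K i))); rewrite -gM !mulg1.
    by rewrite mulg1 subrr addr0.
- by rewrite IH.
- by rewrite IH1 IH2.
Qed.

Definition integral (a : G) (z : free_product X K) : int :=
  word_integral a (repr z).

Local Notation lift := (fp_lift f g).

Lemma integral_word a w : integral a (fp_of_word w) = word_integral a w.
Proof. by apply: word_integral_congruence; exact: fp_repr_word. Qed.

Lemma integralM a y z :
  integral a (y * z) = (integral a y + integral (a * lift y)%g z)%R.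
Proof.
rewrite -(fp_reprK y) -(fp_reprK z) [X in integral _ X]fp_mulE.
by rewrite !integral_word word_integral_cat fp_lift_word.
Qed.

Lemma lift1 : lift 1 = 1.
Proof. by apply: (@mulgI _ (lift 1)); rewrite -fp_liftM // !mulg1. Qed.

Lemma liftV z : lift z^-1 = (lift z)^-1.
Proof. by apply: (@mulgI _ (lift z)); rewrite -fp_liftM // !mulgV lift1. Qed.

Lemma integral1 a : integral a 1 = 0%R.
Proof. by rewrite [LHS](integral_word a [::]). Qed.

(** Since [r] closes up in [G], the path [z] retraces [z^-1] and these two contributions cancel;
    only the base point of [r] has moved. This is why the bounds on relators below are uniform in
    the base point. *)
Lemma integral_conj a r z : lift r = 1 ->
  integral a (r ^ z) = integral (a * (lift z)^-1) r.
Proof.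
move=> r1; rewrite conjgE !integralM r1 mulg1 liftV addrCA.
have := integral1 a; rewrite -{1}(mulVg z) integralM liftV => ->.
by rewrite addr0.
Qed.

Lemma integral_conj_prod B (s : seq (free_product X K * free_product X K)) :
    (forall p, p \in s ->
       lift p.1 = 1 /\ forall a, (`|integral a p.1|%N <= B)%N) ->
  forall a, (`|integral a (\prod_(p <- s) p.1 ^ p.2)%g|%N <= B * size s)%N.
Proof.
elim: s => [|p s IH] sB a; first by rewrite big_nil integral1.
have [p1 pB] := sB p (mem_head _ _).
rewrite big_cons integralM integral_conj //.
have sB' q : q \in s ->
    lift q.1 = 1 /\ forall b, (`|integral b q.1|%N <= B)%N.
  by move=> qs; apply: sB; rewrite inE qs orbT.
have := pB (a * (lift p.2)^-1); have := IH sB' (a * lift (p.1 ^ p.2)).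
by rewrite /= mulnS; move: (integral _ _) (integral _ _) => x y; lia.
Qed.

End WordIntegral.

Section RelativeWords.
Variables (G : groupType) (I : Type) (H : I -> groupClosed G) (X : set G).

Definition fp_of_rel_letter (l : rel_letter H X) : fp_letter X (peripheral H) :=
  match l with
  | GenLetter x => BasisLetter _ x true
  | PeripheralLetter i h _ => FactorLetter X h
  end.

Definition fp_of_rel_word (W : seq (rel_letter H X)) :=
  map fp_of_rel_letter W.

Lemma rel_word_valE W : rel_word_val W = fp_of_word (fp_of_rel_word W).
Proof.
rewrite /rel_word_val; elim: W => [|l W IH]; first by rewrite big_nil.
by rewrite big_cons IH; case: l => [x|i h h1]; exact: fp_mulE.
Qed.

Definition rel_val (w : seq (fp_letter X (peripheral H))) : G :=
  fp_word_val (fun x : X => val x)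
    (fun i (h : peripheral H i) => subgroup_val h) w.

Lemma rel_val_word W :
  rel_free_to_group (rel_word_val W) = rel_val (fp_of_rel_word W).
Proof.
rewrite rel_word_valE /rel_free_to_group fp_lift_word // => i h k.
Qed.

End RelativeWords.

(** * Word metrics and truncated word length *)

Section WordMetric.
Variables (G : groupType) (S : set G).

Definition word_ball (n : nat) (a : G) : Prop :=
  exists l : seq G,
    [/\ (size l <= n)%N, forall s, s \in l -> S s & a = \prod_(s <- l) s].

Lemma word_ball0P a : word_ball 0 a <-> a = 1.
Proof.
split=> [[l [l0 _ ->]]|->]; first by case: l l0 => // _; rewrite big_nil.
by exists [::]; rewrite big_nil.
Qed.

Lemma word_ball_le m n a : (m <= n)%N -> word_ball m a -> word_ball n a.
Proof.
by move=> mn [l [lm lS ->]]; exists l; split=> //; exact: leq_trans mn.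
Qed.

Lemma word_ball_letter s : S s -> word_ball 1 s.
Proof.
by exists [:: s]; rewrite big_seq1; split=> // t; rewrite inE => /eqP ->.
Qed.

Lemma word_ballM m n a b :
  word_ball m a -> word_ball n b -> word_ball (m + n) (a * b).
Proof.
move=> [l [lm lS ->]] [k [kn kS ->]]; exists (l ++ k); rewrite size_cat big_cat.
by split=> //; [lia|move=> s; rewrite mem_cat => /orP[/lS|/kS]].
Qed.

Hypothesis S_inv : forall s, S s -> S s^-1.

Lemma word_ballV n a : word_ball n a -> word_ball n a^-1.
Proof.
move=> [l [ln lS ->]]; elim: l n ln lS => [|s l IH] n.
  by rewrite big_nil invg1 => _ _; exists [::]; rewrite big_nil.
case: n => //= n ln lS; rewrite big_cons invgM -[n.+1]addn1.
apply: word_ballM; first by apply: IH => // t tl; apply: lS; rewrite inE tl orbT.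
by apply/word_ball_letter/S_inv/lS/mem_head.
Qed.

Lemma generated_ball a : generated_subgroup S a -> exists n, word_ball n a.
Proof.
move=> /(_ [set b | exists n, word_ball n b]); apply.
split; last by move=> s /word_ball_letter; exists 1%N.
split; first by exists 0%N; apply/word_ball0P.
by move=> x y [m xm] [n /word_ballV yn]; exists (m + n)%N; exact: word_ballM.
Qed.

Lemma word_ball_generated n a : word_ball n a -> generated_subgroup S a.
Proof.
move=> [l [_ lS ->]] A [[A1 AV] SA]; rewrite big_seq.
apply: (big_ind A) => // [x y Ax Ay|s /lS /SA //].
by have := AV _ _ Ax (AV _ _ A1 Ay); rewrite div1g invgK.
Qed.

(* Truncated because [S] need not generate [G]. *)
Definition truncated_length (M : nat) (a : G) : nat :=
  ex_minn (ex_intro (fun n => `[< word_ball n a \/ n = M >]) M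
             (introT (asboolP _) (or_intror erefl))).

Lemma truncated_length1 M : truncated_length M 1 = 0%N.
Proof.
rewrite /truncated_length; case: ex_minnP => n _ /(_ 0%N).
by rewrite leqn0 => H; apply/eqP/H/asboolP; left; apply/word_ball0P.
Qed.

Lemma truncated_length_lt M a :
  (truncated_length M a < M)%N -> word_ball (truncated_length M a) a.
Proof.
by rewrite /truncated_length; case: ex_minnP => n /asboolP[//|->]; rewrite ltnn.
Qed.

Lemma truncated_lengthM M a s :
  S s -> (truncated_length M (a * s)%g <= (truncated_length M a).+1)%N.
Proof.
move=> Ss; rewrite /truncated_length; case: ex_minnP => m _ m_min.
case: ex_minnP => n /asboolP[an|->] n_min.
  apply: m_min; apply/asboolP; left; rewrite -addn1.
  exact/word_ballM/word_ball_letter.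
by apply: leq_trans (leqnSn _); apply: m_min; apply/asboolP; right.
Qed.

Lemma truncated_length_lipschitz M a s : S s ->
  (`|((truncated_length M (a * s)%g)%:Z - (truncated_length M a)%:Z)%R|%N <= 1)%N.
Proof.
move=> Ss; have := truncated_lengthM M a Ss.
by have := truncated_lengthM M (a * s) (S_inv Ss); rewrite mulgK; lia.
Qed.

Hypothesis S_gen : forall a, exists n, word_ball n a.

Lemma S_genb a : exists n, `[< word_ball n a >].
Proof. by have [n an] := S_gen a; exists n; apply/asboolP. Qed.

Definition word_length (a : G) : nat := ex_minn (S_genb a).

Lemma word_length_ball a : word_ball (word_length a) a.
Proof. by rewrite /word_length; case: ex_minnP => n /asboolP. Qed.

Lemma word_length_le n a : word_ball n a <-> (word_length a <= n)%N.
Proof.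
split=> [an|/word_ball_le]; last by apply; exact: word_length_ball.
by rewrite /word_length; case: ex_minnP => m _; apply; apply/asboolP.
Qed.

Definition word_dist (a b : G) : nat := word_length (a^-1 * b).

Lemma word_dist_refl a : word_dist a a = 0%N.
Proof.
apply/eqP; rewrite -leqn0; apply/word_length_le.
by rewrite mulVg; apply/word_ball0P.
Qed.

Lemma word_dist_sym a b : word_dist a b = word_dist b a.
Proof.
apply/eqP; rewrite eqn_leq; apply/andP; split; apply/word_length_le.
  by have := word_ballV (word_length_ball (b^-1 * a)); rewrite invgM invgK.
by have := word_ballV (word_length_ball (a^-1 * b)); rewrite invgM invgK.
Qed.

Lemma word_dist_triangle a b c :
  (word_dist a c <= word_dist a b + word_dist b c)%N.
Proof.
apply/word_length_le; have -> : a^-1 * c = (a^-1 * b) * (b^-1 * c).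
  by rewrite -mulgA mulVKg.
by apply: word_ballM; exact: word_length_ball.
Qed.

Lemma word_dist_geodesic a b :
  exists2 r, geodesic_on word_dist r (word_dist a b) &
             r 0%N = a /\ r (word_dist a b) = b.
Proof.
have [l [ln lS lE]] := word_length_ball (a^-1 * b).
rewrite -/(word_dist a b) in ln *; set n := word_dist a b in ln *.
pose r i := a * \prod_(s <- take i l) s.
have r0 : r 0%N = a by rewrite /r take0 big_nil mulg1.
have rn : r n = b by rewrite /r take_oversize // -lE mulVKg.
have r_le i j : (i <= j)%N -> (word_dist (r i) (r j) <= j - i)%N.
  move=> ij; apply/word_length_le; exists (take (j - i) (drop i l)).
  split; first by rewrite size_take_min geq_minl.
    by move=> s /mem_take /mem_drop /lS.
  have tE : take j l = take i l ++ take (j - i) (drop i l) by rewrite -takeD subnKC.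
  rewrite /r tE big_cat /= invgM.
  by rewrite !mulgA mulgVK mulVg mul1g.
exists r => // i j /andP[ij jn].
have := word_dist_triangle (r 0%N) (r i) (r n).
have := word_dist_triangle (r i) (r j) (r n).
have := r_le _ _ ij; have := r_le 0%N i isT; have := r_le j n jn.
have : word_dist (r 0%N) (r n) = n by rewrite r0 rn.
lia.
Qed.

End WordMetric.

(** * Relative presentations *)

Section RelativeGeneration.
Variables (G : groupType) (I : Type) (H : I -> groupClosed G).

Definition rel_generators (X : set G) : set G := X `|` \bigcup_i [set` H i].

Lemma rel_generatorsV X : [set x^-1 | x in X] = X ->
  forall s, rel_generators X s -> rel_generators X s^-1.
Proof.
move=> Xsym s [Xs|[i _ Hs]]; first by left; rewrite -Xsym; exists s.
by right; exists i => //=; rewrite gpredV.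
Qed.

Lemma rel_generators_ball X : relative_generating_set H X ->
  forall a, exists n, word_ball (rel_generators X) n a.
Proof.
move=> [Xsym Xgen] a; apply: (generated_ball (rel_generatorsV Xsym)).
by rewrite /rel_generators Xgen.
Qed.

Lemma subgroup_valM_peripheral i :
  {morph (fun h : peripheral H i => subgroup_val h) : h k / h * k}.
Proof. by move=> h k; exact: (valM (h : subgroup_type (H i))). Qed.

Lemma rel_val_cat (X : set G) (v w : seq (fp_letter X (peripheral H))) :
  rel_val (v ++ w) = rel_val v * rel_val w.
Proof. exact: big_cat. Qed.

Lemma rel_word_letter (X : set G) s : rel_generators X s ->
  exists W : seq (rel_letter H X),
    (size W <= 1)%N /\ rel_val (fp_of_rel_word W) = s.
Proof.
move=> [Xs|[i _ Hs]].
  exists [:: GenLetter H (SigSub (mem_set Xs))]; split=> //.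
  by rewrite /rel_val /fp_word_val big_seq1.
have [h1|h1] := eqVneq (SubgroupElement Hs : peripheral H i) 1.
  exists [::]; split=> //; rewrite /rel_val /fp_word_val big_nil.
  exact: (esym (congr1 (@subgroup_val _ _) h1)).
exists [:: PeripheralLetter X h1]; split=> //.
by rewrite /rel_val /fp_word_val big_seq1.
Qed.

Lemma rel_word_of_ball (X : set G) n a : word_ball (rel_generators X) n a ->
  exists W : seq (rel_letter H X),
    (size W <= n)%N /\ rel_val (fp_of_rel_word W) = a.
Proof.
move=> [l [ln lS ->]]; suff: exists W : seq (rel_letter H X),
    (size W <= size l)%N /\ rel_val (fp_of_rel_word W) = \prod_(s <- l) s.
  by move=> [W [Wl ?]]; exists W; split=> //; exact: leq_trans ln.
elim: l lS {ln} => [|s l IH] lS.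
  by exists [::]; rewrite big_nil /rel_val /fp_word_val big_nil.
have [|W [Wl Wv]] := IH; first by move=> t tl; apply: lS; rewrite inE tl orbT.
have [V [V1 Vs]] := rel_word_letter (lS s (mem_head _ _)).
exists (V ++ W); rewrite size_cat /fp_of_rel_word map_cat rel_val_cat big_cons.
by rewrite -/(fp_of_rel_word _) -/(fp_of_rel_word W) Vs Wv; split=> //=; lia.
Qed.

(** This trades the extended real Dehn function for an explicit product of conjugates with a natural
    constant [K], and puts relators and their inverses into one finite list. *)
Lemma relatively_hyperbolic_isoperimetry : relatively_hyperbolic H ->
  exists (X : set G) (rs : seq (rel_free H X)) (K : nat),
  [/\ relative_generating_set H X, finite_set X,
      forall r, r \in rs -> rel_free_to_group r = 1 &
      forall W : seq (rel_letter H X), rel_val (fp_of_rel_word W) = 1 ->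
      exists s : seq (rel_free H X * rel_free H X),
      [/\ (size s <= K * (size W).+1)%N, forall p, p \in s -> p.1 \in rs &
          fp_of_word (fp_of_rel_word W) = \prod_(p <- s) p.1 ^ p.2]].
Proof.
move=> [X [rels [[Xgen Xfin rels_fin kerE] [C dehn]]]].
have [rs rsE] := (finite_seqP rels).1 rels_fin.
have rels1 r : rels r -> rel_free_to_group r = 1.
  move=> rr; suff: [set a | rel_free_to_group a = 1] r by [].
  by rewrite kerE; exact: sub_gen_smallest.
pose rs' : seq (rel_free H X) := rs ++ map (fun r => r^-1) rs.
have rs'1 r : r \in rs' -> rel_free_to_group r = 1.
  rewrite mem_cat => /orP[rr|/mapP[q qr ->]]; first by apply: rels1; rewrite rsE.
  rewrite /rel_free_to_group liftV //.
  by rewrite [X in X^-1]rels1 ?invg1 // rsE.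
have [K CK] : exists K : nat, (`|C| < K%:R)%R.
  by exists (Num.bound (`|C|%R)); rewrite archi_boundP.
exists X, rs', K; split=> // W W1.
have areaW : (relative_area rels W <= (C * (size W)%:R)%R%:E)%E.
  apply: le_trans (dehn (size W)); apply: ereal_sup_ubound.
  by exists W => //; split=> //; rewrite rel_val_word.
(* The successor makes the bound strict even for the empty word, so some actual number of factors
   lies below it although the area is an infimum. *)
have {}CK : (C * (size W)%:R < (K * (size W).+1)%:R :> Rdefinitions.R)%R.
  apply: (@le_lt_trans _ _ (K%:R * (size W)%:R)%R).
    by rewrite ler_wpM2r // (le_trans (ler_norm _)) // ltW.
  rewrite -natrM ltr_nat ltn_mul2l ltnSn andbT -(ltr_nat Rdefinitions.R).
  exact: le_lt_trans (normr_ge0 C) CK.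
have {areaW CK} area_lt : (relative_area rels W < (K * (size W).+1)%:R%:E)%E.
  by apply: le_lt_trans areaW _; rewrite lte_fin.
have [_ [k [s [sk srels sE]] <-]] := ereal_inf_lt area_lt.
rewrite lte_fin ltr_nat => k_lt; exists s; split.
- by rewrite sk ltnW.
- move=> p /srels; rewrite rsE mem_cat /= => -[->//|pr].
  by apply/orP; right; apply/mapP; exists p.1^-1; rewrite ?invgK.
- by rewrite -rel_word_valE.
Qed.

End RelativeGeneration.

(** * Finite generation and undistortion of [Q] *)

Section Undistorted.
Variables (G : groupType) (I : Type) (H : I -> groupClosed G).
Variable Q : groupClosed G.

Local Notation QT := (subgroup_type Q).
Local Notation HQ := (adjoin_subgroup H Q).

Definition adjoined_part (X : set G) (l : fp_letter X (peripheral HQ)) :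
    option QT :=
  match l with
  | BasisLetter _ _ => None
  | FactorLetter o h =>
      match o return peripheral HQ o -> option QT with
      | Some _ => fun _ => None
      | None => fun h => Some h
      end h
  end.

Definition adjoined_parts_in (X : set G) (Y : set QT) (w : seq _) : Prop :=
  forall (l : fp_letter X (peripheral HQ)) y,
    l \in w -> adjoined_part l = Some y -> Y y.

Lemma adjoined_parts_in_cat (X : set G) Y
    (v w : seq (fp_letter X (peripheral HQ))) :
  adjoined_parts_in Y v -> adjoined_parts_in Y w ->
  adjoined_parts_in Y (v ++ w).
Proof.
by move=> vY wY l y; rewrite mem_cat => /orP[lv|lw]; [apply: vY|apply: wY].
Qed.

(** The set [X1] is not the generating set [X] of the presentation that includes [Q]. Each of its
    elements is rewritten over that presentation, and the letters of [Q] so introduced join those of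
    the relators in [Y]. *)
Lemma hyperbolically_embedded_undistorted (X1 : set G) :
  finite_set X1 -> hyperbolically_embedded H Q ->
  exists (Y : set QT) (A : nat),
  [/\ finite_set Y, forall y, Y y -> Y y^-1 &
      forall n (q : QT), word_ball (rel_generators H X1) n (subgroup_val q) ->
      word_ball Y (A * n.+1) q].
Proof.
move=> /finite_seqP[xs xsE] /relatively_hyperbolic_isoperimetry.
move=> [X [rs [K [Xgen Xfin rs1 iso]]]].
have word_ex a : exists W : seq (rel_letter HQ X), rel_val (fp_of_rel_word W) = a.
  have [n /rel_word_of_ball[W [_ ?]]] := rel_generators_ball Xgen a.
  by exists W.
have [W0 W0v] := choice word_ex.
pose ws := [seq fp_of_rel_word (W0 x) | x <- xs] ++
           [seq (repr r : seq (fp_letter X (peripheral HQ))) | r <- rs].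
pose ys := pmap (@adjoined_part X) (flatten ws).
pose Y : set QT := [set` ys ++ [seq y^-1 | y <- ys]].
have Yin w : w \in ws -> adjoined_parts_in Y w.
  move=> ww l y lw ly; rewrite /Y /= mem_cat mem_pmap; apply/orP; left.
  by apply/mapP; exists l => //; apply/flattenP; exists w.
have YV y : Y y -> Y y^-1.
  rewrite /Y /= !mem_cat => /orP[yy|/mapP[z zy ->]]; apply/orP.
    by right; apply/mapP; exists y.
  by left; rewrite invgK.
(* The successor makes room for a single letter of some [H i]. *)
pose M := (\max_(x <- xs) size (W0 x)).+1.
pose B := \max_(r <- rs) size (repr r).
have rewriteQ n a : word_ball (rel_generators H X1) n a ->
    exists W : seq (rel_letter HQ X),
    [/\ (size W <= M * n)%N, rel_val (fp_of_rel_word W) = a &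
        adjoined_parts_in Y (fp_of_rel_word W)].
  move=> [l [ln lS ->]].
  suff: exists W : seq (rel_letter HQ X),
      [/\ (size W <= M * size l)%N,
          rel_val (fp_of_rel_word W) = \prod_(s <- l) s &
          adjoined_parts_in Y (fp_of_rel_word W)].
    move=> [W [Wl Wv WY]]; exists W; split=> //.
    by rewrite (leq_trans Wl) // leq_mul2l ln orbT.
  elim: l lS {ln} => [|s l IH] lS.
    by exists [::]; rewrite big_nil /rel_val /fp_word_val big_nil.
  have [|W [Wl Wv WY]] := IH; first by move=> t tl; apply: lS; rewrite inE tl orbT.
  have [V [V1 Vs VY]] : exists V : seq (rel_letter HQ X),
      [/\ (size V <= M)%N, rel_val (fp_of_rel_word V) = s &
          adjoined_parts_in Y (fp_of_rel_word V)].
    have [Xs|[i _ Hs]] := lS s (mem_head _ _).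
      rewrite xsE /= in Xs; exists (W0 s); split=> //.
        by rewrite /M leqW // (leq_bigmax_seq (F := fun x => size (W0 x))).
      by apply: Yin; rewrite mem_cat; apply/orP; left; apply/mapP; exists s.
    have [h1|h1] := eqVneq (SubgroupElement Hs : peripheral HQ (Some i)) 1.
      exists [::]; split=> //; rewrite /rel_val /fp_word_val big_nil.
      exact: (esym (congr1 (@subgroup_val _ _) h1)).
    exists [:: PeripheralLetter X h1]; split=> //.
      by rewrite /rel_val /fp_word_val big_seq1.
    by move=> t y; rewrite inE => /eqP ->.
  exists (V ++ W); rewrite size_cat /fp_of_rel_word map_cat rel_val_cat big_cons.
  rewrite -/(fp_of_rel_word _) -/(fp_of_rel_word W) Vs Wv; split=> //.
    by rewrite mulnS leq_add.
  exact: adjoined_parts_in_cat.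
(* [M * n] bounds the integral of the rewritten word; [K * (M * n + 2)] counts the relators, the 2
   coming from the closing letter and from the successor in the isoperimetric bound; each relator
   costs at most [B]. *)
exists Y, (M + B * (K * (M + 2)))%N; split=> //; first exact: finite_seq.
move=> n q qn; set N := (_ * n.+1)%N.
(* The closing letter [q^-1] has to be a nontrivial element. *)
have [q1|q1] := eqVneq q 1.
  by rewrite q1; apply: word_ball_le (leq0n _) _; apply/word_ball0P.
have [W [Wn Wv WY]] := rewriteQ _ _ qn.
pose S : set G := [set subgroup_val y | y in Y].
have SV s : S s -> S s^-1.
  by move=> [y /YV Yy <-]; exists y^-1.
(* Truncating at [N.+1] is enough: the bound [N] obtained for [F] at [q] shows that the truncation
   is not attained there. *)
pose F (a : G) : int := truncated_length S N.+1 a.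
pose c (_ : X) (_ : G) : int := 0%R.
pose u (o : option I) (a : G) : int := if o is None then F a else 0%R.
pose f (x : X) : G := val x.
pose g (o : option I) (h : peripheral HQ o) : G := subgroup_val h.
have gM o : {morph @g o : h k / h * k} by exact: subgroup_valM_peripheral.
have short w a : adjoined_parts_in Y w ->
    (`|word_integral f g c u a w|%N <= size w)%N.
  elim: w a => //= l w IH a wY.
  have {}IH b : (`|word_integral f g c u b w|%N <= size w)%N.
    by apply: IH => k y kw; apply: wY; rewrite inE kw orbT.
  suff l1 : (`|letter_integral f g c u a l|%N <= 1)%N.
    have := IH (a * fp_letter_val f g l).
    by move: (word_integral _ _ _ _ _ _) l1 => x; lia.
  have {}wY := wY l _ (mem_head _ _).
  case: l wY => [x b _|[i|] h] /=; [by case: b|by []|].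
  move=> /(_ h erefl) Yh; rewrite /u /F.
  by apply: truncated_length_lipschitz SV _ _ _ _; exists h.
have qV1 : (q^-1 : peripheral HQ None) != 1 by rewrite invg_eq1.
pose V := W ++ [:: PeripheralLetter X qV1].
have Vv : rel_val (fp_of_rel_word V) = 1.
  rewrite /V /fp_of_rel_word map_cat rel_val_cat -/(fp_of_rel_word W) Wv.
  rewrite /rel_val /fp_word_val big_seq1 /= -[X in X * _](mulg1 _).
  by rewrite mulg1 -(valM (q : QT) q^-1) mulgV.
have [s [sV srs sE]] := iso V Vv.
have := @integral_conj_prod _ _ _ _ f g gM c u B s _ 1.
rewrite -sE integral_word // /V /fp_of_rel_word map_cat word_integral_cat.
rewrite -/(fp_of_rel_word W) -/(rel_val _) Wv /= mul1g addr0.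
have -> : subgroup_val q * g None q^-1 = 1.
  by rewrite /g -(valM (q : QT) q^-1) mulgV.
rewrite {1}/F truncated_length1 sub0r.
have := short _ 1 WY; rewrite size_map.
set x := word_integral _ _ _ _ _ _ => xW sB.
(* The closing letter leads from [q] to 1, where [F] vanishes, and so adds minus the value of [F] at
   [q] to the integral [x] of [W]. *)
have {}sB : (`|x - F (subgroup_val q)|%N <= B * size s)%N.
  apply: sB => p /srs pr; split; first exact: rs1.
  move=> a; apply: leq_trans (short _ _ _) _.
    by apply: Yin; rewrite mem_cat; apply/orP; right; apply/mapP; exists p.1.
  exact: (leq_bigmax_seq (F := fun r => size (repr r))).
have FN : (truncated_length S N.+1 (subgroup_val q) <= N)%N.
  move: sB xW; rewrite /F; move: (truncated_length _ _ _) => t.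
  have : (B * size s <= B * (K * (M * n + 2)))%N.
    rewrite leq_mul2l (leq_trans sV) ?orbT // leq_mul2l size_cat /=.
    by apply/orP; right; lia.
  have : (B * (K * (M * n + 2)) <= B * (K * ((M + 2) * n.+1)))%N.
    by rewrite !leq_mul2l; apply/orP; right; apply/orP; right; lia.
  by rewrite /N; nia.
have [l [lN lS lE]] := truncated_length_lt (FN : _ < N.+1)%N.
have {}lS t : t \in l -> exists y : QT, Y y /\ subgroup_val y = t.
  by move=> /lS [y Yy <-]; exists y.
suff [k [kY kl kE]] : exists k : seq QT,
    [/\ forall y, y \in k -> Y y, size k = size l &
        subgroup_val (\prod_(y <- k) y) = \prod_(t <- l) t].
  exists k; split=> //; first by rewrite kl (leq_trans lN).
  by apply: val_inj; rewrite /= lE.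
elim: l lS {lN lE} => [|t l IH] lS; first by exists [::]; rewrite !big_nil.
have [|k [kY kl kE]] := IH; first by move=> r rl; apply: lS; rewrite inE rl orbT.
have [y [Yy yt]] := lS t (mem_head _ _).
exists (y :: k); rewrite !big_cons /= kl; split=> //.
  by move=> z; rewrite inE => /orP[/eqP ->|/kY].
by rewrite -yt -kE; exact: (valM (y : QT)).
Qed.

End Undistorted.

(** * Planar area of triangles and Lipschitz extension *)

Lemma area_formN (T : Type) (f g : T -> int) a b :
  area_form f g b a = (- area_form f g a b)%R.
Proof. by rewrite /area_form; ring. Qed.

(** The right-hand side is the determinant of the two sides at [a], that is, twice the signed area
    of the image triangle. *)
Lemma area_form_triangle (T : Type) (f g : T -> int) a b c :
  (area_form f g a b + area_form f g b c - area_form f g a c =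
   (f b - f a) * (g c - g a) - (f c - f a) * (g b - g a))%R.
Proof. by rewrite /area_form; ring. Qed.

Lemma area_form_triangle_le (T : Type) (f g : T -> int) a b c m n :
    (`|(f b - f a)%R|%N <= m)%N -> (`|(g b - g a)%R|%N <= m)%N ->
    (`|(f c - f a)%R|%N <= n)%N -> (`|(g c - g a)%R|%N <= n)%N ->
  (`|(area_form f g a b + area_form f g b c - area_form f g a c)%R|%N
     <= 2 * (m * n))%N.
Proof.
move=> fb gb fc gc; rewrite area_form_triangle.
have := leq_mul fb gc; have := leq_mul fc gb; rewrite -!abszM.
by rewrite (mulnC n); lia.
Qed.

(* McShane's extension [a |-> inf_p (f p + D d(p, a))]. *)
Lemma lipschitz_extension (G : groupType) (S : set G) (T : Type) (e : T -> G)
    (p0 : T) (D : nat) (f : T -> nat) :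
    (forall s, S s -> S s^-1) -> (forall a, exists n, word_ball S n a) ->
    (forall p q n, word_ball S n ((e p)^-1 * e q) -> (f q <= f p + D * n)%N) ->
  exists F : G -> nat, (forall q, F (e q) = f q) /\
    forall a s, S s -> (`|((F (a * s)%g)%:Z - (F a)%:Z)%R|%N <= D)%N.
Proof.
move=> SV Sgen flip.
pose P a m :=
  `[< exists p n, word_ball S n ((e p)^-1 * a) /\ m = (f p + D * n)%N >].
have Pex a : exists m, P a m.
  have [n an] := Sgen ((e p0)^-1 * a).
  by exists (f p0 + D * n)%N; apply/asboolP; exists p0, n.
pose F a := ex_minn (Pex a).
have FM a s : S s -> (F (a * s)%g <= F a + D)%N.
  move=> Ss; rewrite {2}/F; case: ex_minnP => m /asboolP[p [n [an ->]]] _.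
  rewrite /F; case: ex_minnP => k _; apply.
  apply/asboolP; exists p, (n + 1)%N; split; last by lia.
  by rewrite mulgA; apply: word_ballM an (word_ball_letter Ss).
exists F; split=> [q|a s Ss].
  rewrite /F; case: ex_minnP => m /asboolP[p [n [pn ->]]] m_min.
  apply/eqP; rewrite eqn_leq flip // andbT; apply: m_min.
  apply/asboolP; exists q, 0%N; rewrite mulVg muln0 addn0; split=> //.
  exact/word_ball0P.
by have := FM a s Ss; have := FM (a * s) _ (SV _ Ss); rewrite mulgK; lia.
Qed.

Lemma distn_add_le (a b c d : int) (m n : nat) :
  (`|(a - c)%R|%N <= m)%N -> (`|(b - d)%R|%N <= n)%N ->
  (`|((a + b) - (c + d))%R|%N <= m + n)%N.
Proof. by lia. Qed.

Lemma distn_le (a b : int) (m n : nat) :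
  (`|(a - b)%R|%N <= m)%N -> (`|a|%N <= n)%N -> (`|b|%N <= m + n)%N.
Proof. by lia. Qed.

(** * Integration along chords of cosets *)

Section ChordIntegral.
Variables (G : groupType) (I : Type) (H : I -> groupClosed G) (X : set G).
Variables (F1 F2 : G -> int) (D : nat).
Hypothesis Xsym : [set x^-1 | x in X] = X.
Hypothesis F1_lip : forall a s, rel_generators H X s ->
  (`|(F1 (a * s)%g - F1 a)%R|%N <= D)%N.
Hypothesis F2_lip : forall a s, rel_generators H X s ->
  (`|(F2 (a * s)%g - F2 a)%R|%N <= D)%N.

(** A representative chosen from the left coset of [a] as a set, hence the same for all its
    elements; the default 1 never arises, since the coset contains [a]. *)
Definition coset_base (i : I) (a : G) : G := xget 1 [set b | a^-1 * b \in H i].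

Lemma coset_baseP i a : a^-1 * coset_base i a \in H i.
Proof.
rewrite /coset_base; case: xgetP => [b _ //|] /(_ a) /=.
by rewrite mulVg gpred1.
Qed.

Lemma coset_baseM i a h : h \in H i -> coset_base i (a * h) = coset_base i a.
Proof.
move=> Hh; congr xget; apply/funext => b /=; apply/propext.
rewrite invgM -mulgA; split=> Hb.
  by rewrite -[a^-1 * b](mulVKg h) gpredM.
by rewrite gpredM ?gpredV.
Qed.

(* An edge inside a coset of [H i] is replaced by the two chords through the
   base point of the coset, so that relations of [H i] contribute no area. *)
Definition chord_basis (x : X) (a : G) : int := area_form F1 F2 a (a * val x).
Definition chord_factor (i : I) (a : G) : int :=
  area_form F1 F2 (coset_base i a) a.

Local Notation fval := (fun x : X => val x).
Local Notation gval := (fun i (h : peripheral H i) => subgroup_val h).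
Local Notation letter_val := (fp_letter_val fval gval).
Local Notation wint := (word_integral fval gval chord_basis chord_factor).

Lemma letter_val_generator l : rel_generators H X (letter_val l).
Proof.
case: l => [x b|i h] /=; last by right; exists i => //=; case: h.
have Xx : X (val x) by exact: set_valP.
by case: b; [left|apply: (rel_generatorsV Xsym); left].
Qed.

Lemma rel_val_lipschitz (F : G -> int) :
    (forall a s, rel_generators H X s -> (`|(F (a * s)%g - F a)%R|%N <= D)%N) ->
  forall (w : seq (fp_letter X (peripheral H))) a,
  (`|(F (a * rel_val w)%g - F a)%R|%N <= D * size w)%N.
Proof.
move=> F_lip; elim=> [|l w IH] a.
  by rewrite /rel_val /fp_word_val big_nil mulg1 subrr.
have := IH (a * letter_val l); have := F_lip a _ (letter_val_generator l).
rewrite /rel_val /fp_word_val big_cons mulgA /= mulnS.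
by move: (F _) (F _) (F _) => x y z; lia.
Qed.

(** For a letter of [H i] the difference is the triangle formed by [a], the base point and [a * h].
    Both sides at [a] are single generators, so [F1] and [F2] vary by at most [D] along them. *)
Lemma letter_integral_chord l a :
  (`|(letter_integral fval gval chord_basis chord_factor a l
      - area_form F1 F2 a (a * letter_val l)%g)%R|%N <= 2 * (D * D))%N.
Proof.
case: l => [x b|i h] /=.
  case: b; rewrite /chord_basis ?subrr //.
  by rewrite mulgVK area_formN opprK subrr.
have Hh : subgroup_val h \in H i by case: h.
rewrite /chord_factor coset_baseM //; set r := coset_base i a.
rewrite (area_formN _ _ a r) opprK addrC.
have ra : rel_generators H X (a^-1 * r).
  by right; exists i => //; exact: coset_baseP.
have ha : rel_generators H X (subgroup_val h) by right; exists i.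
have := F1_lip a ra; have := F2_lip a ra; rewrite mulVKg => r2 r1.
have := area_form_triangle_le r1 r2 (F1_lip a ha) (F2_lip a ha).
move: (area_form _ _ _ _) (area_form _ _ _ _) (area_form _ _ _ _).
by move=> x y z; lia.
Qed.

Definition chord_error (n : nat) : nat := (2 * (D * D) * (n * n.+1))%N.

(** Splitting off the first letter leaves a triangle with sides of size [D] and [D * size w], which
    sum to a quadratic error. This suffices because it is applied only to words of bounded length:
    relators and rewritten generators. *)
Lemma word_integral_chord w a :
  (`|(wint a w - area_form F1 F2 a (a * rel_val w)%g)%R|%N
     <= chord_error (size w))%N.
Proof.
elim: w a => [|l w IH] a.
  by rewrite /rel_val /fp_word_val big_nil mulg1 /area_form /= subrr mulr0.
have l1 := F1_lip a (letter_val_generator l).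
have l2 := F2_lip a (letter_val_generator l).
have := area_form_triangle_le l1 l2
  (rel_val_lipschitz F1_lip (l :: w) a) (rel_val_lipschitz F2_lip (l :: w) a).
have := IH (a * letter_val l); have := letter_integral_chord l a.
rewrite /rel_val /fp_word_val big_cons mulgA /= /chord_error.
move: (area_form _ _ _ _) (area_form _ _ _ _) (area_form _ _ _ _) => x y z.
move: (letter_integral _ _ _ _ _ _) (wint _ _) => p q.
move: (size w) => n; nia.
Qed.

End ChordIntegral.

(** A closed walk in [Q] is rewritten step by step as a word over [X] and the [H i] that represents
    1. Its integral differs from the area along the walk by a bounded error per step, and is bounded
    by its number of relators. *)
Lemma embedded_linear_area (G : groupType) (I : Type) (H : I -> groupClosed G)
    (Q : groupClosed G) :
  relatively_hyperbolic H -> hyperbolically_embedded H Q ->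
  exists (Y : set (subgroup_type Q))
    (Ygen : forall a, exists n, word_ball Y n a) (K : nat),
  [/\ finite_set Y, forall y, Y y -> Y y^-1 & linear_area (word_dist Ygen) K].
Proof.
move=> /relatively_hyperbolic_isoperimetry[X [rs [K0 [Xgen Xfin rs1 iso]]]].
move=> /(hyperbolically_embedded_undistorted Xfin)[Y [A [Yfin YV distort]]].
have [Xsym _] := Xgen.
have SV := rel_generatorsV (H := H) Xsym.
have Sgen := rel_generators_ball Xgen.
have Ygen a : exists n, word_ball Y n a.
  by have [n /distort] := Sgen (subgroup_val a); exists (A * n.+1)%N.
exists Y, Ygen.
(* Since [A * n.+1 <= 2 * A * n] for positive [n], doubling removes the additive constant; at
   [n = 0] the element is 1. *)
pose D := (2 * A)%N.
have distortD n (q : subgroup_type Q) :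
    word_ball (rel_generators H X) n (subgroup_val q) -> word_ball Y (D * n) q.
  case: n => [/word_ball0P q1|n /distort].
    by rewrite muln0; apply/word_ball0P; exact: val_inj.
  by apply: word_ball_le; rewrite /D; lia.
have word_ex a : exists W : seq (rel_letter H X), rel_val (fp_of_rel_word W) = a.
  have [n /rel_word_of_ball[W [_ ?]]] := Sgen a.
  by exists W.
have [W0 W0v] := choice word_ex.
have [ys ysE] := (finite_seqP Y).1 Yfin.
pose L := \max_(y <- ys) size (W0 (subgroup_val y)).
pose B := chord_error D (\max_(r <- rs) size (repr r)).
exists (chord_error D L + B * K0 * L.+1)%N.
split=> // f g f_lip g_lip x s xs xE.
have extend (h : subgroup_type Q -> nat) : lipschitz1 (word_dist Ygen) h ->
    exists F : G -> nat,
      (forall q : subgroup_type Q, F (subgroup_val q) = h q) /\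
      forall a t, rel_generators H X t ->
        (`|((F (a * t)%g)%:Z - (F a)%:Z)%R|%N <= D)%N.
  (* Undistortion makes [h] a [D]-Lipschitz function for the metric of [G] restricted to [Q]. *)
  move=> h_lip; apply: (lipschitz_extension 1) => // p q n.
  rewrite -[_^-1 * _]/(subgroup_val (p^-1 * q)).
  move=> /distortD /(word_length_le Ygen) pq.
  apply: leq_trans (h_lip q p) _.
  by rewrite leq_add2l word_dist_sym.
have [F [Ff F_lip]] := extend f f_lip; have [E [Eg E_lip]] := extend g g_lip.
pose wint := word_integral (fun x : X => val x)
  (fun i (h : peripheral H i) => subgroup_val h)
  (chord_basis (Posz \o F) (Posz \o E)) (chord_factor H (Posz \o F) (Posz \o E)).
have chord := word_integral_chord (F1 := Posz \o F) (F2 := Posz \o E) Xsym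
  F_lip E_lip.
have error_le m n : (m <= n)%N -> (chord_error D m <= chord_error D n)%N.
  by move=> mn; rewrite /chord_error !leq_mul.
have step (p q : subgroup_type Q) : (word_dist Ygen p q <= 1)%N ->
    exists V : seq (rel_letter H X),
      (size V <= L)%N /\ rel_val (fp_of_rel_word V) = subgroup_val (p^-1 * q).
  move=> /word_length_le[l [l1 lY ->]]; case: l l1 lY => [|t [|//]] _ tY.
    by exists [::]; rewrite big_nil /rel_val /fp_word_val big_nil.
  exists (W0 (subgroup_val t)); rewrite big_seq1; split=> //.
  have := tY t (mem_head _ _); rewrite ysE => tys.
  exact: (leq_bigmax_seq (F := fun y => size (W0 (subgroup_val y)))).
have along : forall s p, path (fun a b => (word_dist Ygen a b <= 1)%N) p s ->
    exists W : seq (rel_letter H X),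
    [/\ (size W <= L * size s)%N,
        rel_val (fp_of_rel_word W) = subgroup_val (p^-1 * last p s) &
        (`|(wint (subgroup_val p) (fp_of_rel_word W) -
            area_along (Posz \o f) (Posz \o g) p s)%R|%N
           <= chord_error D L * size s)%N].
  elim=> [|q t IH] p /=.
    by exists [::]; rewrite mulVg /rel_val /fp_word_val big_nil.
  move=> /andP[/step[V [VL Vv]] /IH[W [Wt Wv Wa]]].
  exists (V ++ W); rewrite size_cat /fp_of_rel_word map_cat rel_val_cat.
  rewrite -/(fp_of_rel_word _) -/(fp_of_rel_word W) Vv Wv; split.
  - by rewrite mulnS leq_add.
  - by rewrite -(valM (p^-1 * q : subgroup_type Q)) -mulgA mulVKg.
  have pq : subgroup_val p * subgroup_val (p^-1 * q) = subgroup_val q.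
    by rewrite -(valM (p : subgroup_type Q)) mulVKg.
  have := chord (fp_of_rel_word V) (subgroup_val p).
  rewrite /wint word_integral_cat -/(rel_val _) Vv pq -/wint.
  rewrite {1}/area_form /= !Ff !Eg -/(area_form (Posz \o f) (Posz \o g) p q).
  rewrite size_map => chordV; rewrite mulnS.
  exact: distn_add_le (leq_trans chordV (error_le _ _ VL)) Wa.
have [W [Ws]] := along s x xs; rewrite xE mulVg => W1 Wa.
have [l [lW lrs lE]] := iso W W1.
have := @integral_conj_prod _ _ _ _ (fun x : X => val x)
  (fun i (h : peripheral H i) => subgroup_val h)
  (@subgroup_valM_peripheral _ _ H) (chord_basis (Posz \o F) (Posz \o E))
  (chord_factor H (Posz \o F) (Posz \o E)) B l _ (subgroup_val x).
rewrite -lE integral_word //.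
rewrite -/wint => lB.
have {}lB : (`|wint (subgroup_val x) (fp_of_rel_word W)|%N <= B * size l)%N.
  apply: lB => p /lrs pr; split; first exact: rs1.
  move=> a; have := chord (repr p.1) a.
  (* A relator closes up, so its chord from [a] to [a] has no area and only the chord error
     remains. *)
  have -> : rel_val (repr p.1 : seq (fp_letter X (peripheral H))) = 1.
    exact: (rs1 _ pr).
  rewrite mulg1 {1}/area_form subrr mulr0 subr0 => pa.
  apply: leq_trans pa _; apply: error_le.
  exact: (leq_bigmax_seq (F := fun r => size (repr r))).
have BW : (B * size l <= B * K0 * (L.+1 * (size s).+1))%N.
  rewrite -mulnA !leq_mul2l; apply/orP; right; apply: leq_trans lW _.
  by rewrite leq_mul2l; apply/orP; right; nia.
apply: leq_trans (distn_le Wa (leq_trans lB BW)) _.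
by rewrite mulnDl leq_add // ?mulnA // leq_mul2l leqnSn orbT.
Qed.

(** * Cayley graphs *)

Lemma inf_attained (A : set Rdefinitions.R) (x : Rdefinitions.R) :
  A x -> lbound A x -> inf A = x.
Proof.
move=> Ax xA; apply/eqP; rewrite eq_le ge_inf //=; last by exists x.
by apply: lb_le_inf xA; exists x.
Qed.

Section CayleyGraph.
Variables (G : groupType) (S : set G).
Hypothesis S_inv : forall s, S s -> S s^-1.
Hypothesis S_gen : forall a, exists n, word_ball S n a.

Local Notation wd := (word_dist S_gen).

Lemma cayley_adjacentP a b : reflect (S (a^-1 * b)) (cayley_adjacent S a b).
Proof.
apply: (iffP (asboolP _)) => [[s Ss [->|->]]|Sab].
- by rewrite mulKg.
- by rewrite invgM mulgVK; exact: S_inv.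
- by exists (a^-1 * b) => //; left; rewrite mulVKg.
Qed.

Lemma cayley_path_dist p a :
  path (cayley_adjacent S) a p -> (wd a (last a p) <= size p)%N.
Proof.
elim: p a => [|b p IH] a /=; first by rewrite word_dist_refl.
move=> /andP[/cayley_adjacentP ab /IH bp].
have ab1 : (wd a b <= 1)%N by apply/word_length_le; exact: word_ball_letter.
by have := word_dist_triangle S_gen a b (last b p); lia.
Qed.

Lemma cayley_path_exists a b : exists p,
  [/\ path (cayley_adjacent S) a p, last a p = b & size p = wd a b].
Proof.
have [l [ln lS lE]] := word_length_ball S_gen (a^-1 * b).
have bE : b = a * \prod_(s <- l) s by rewrite -lE mulVKg.
have [p [pa pl ps]] : exists p, [/\ path (cayley_adjacent S) a p,
    last a p = b & size p = size l].
  rewrite {}bE; elim: l a lS {ln lE} => [|s l IH] a lS.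
    by exists [::]; rewrite big_nil mulg1.
  have [|p [pa pl ps]] := IH (a * s).
    by move=> t tl; apply: lS; rewrite inE tl orbT.
  exists (a * s :: p); rewrite /= ps pl big_cons mulgA; split=> //.
  rewrite pa andbT; apply/cayley_adjacentP; rewrite mulKg.
  exact/lS/mem_head.
exists p; split=> //; apply/eqP; rewrite eqn_leq ps ln -ps -pl /=.
exact: cayley_path_dist.
Qed.

Lemma cayley_vertex_distE a b : cayley_vertex_dist S a b = ((wd a b)%:R)%R.
Proof.
apply: inf_attained.
  by have [p [pa pb ps]] := cayley_path_exists a b; exists p; rewrite ?ps.
move=> _ [p [pa <-] <-]; rewrite ler_nat; exact: cayley_path_dist.
Qed.

Definition cell_origin (p : cayley_point S) : G :=
  match p with VertexPoint g => g | EdgePoint g _ _ _ => g end.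

Lemma cell_ends_origin p :
  exists2 t : Rdefinitions.R,
    (cell_origin p, t) \in cell_ends p & (0 <= t <= 1)%R.
Proof.
case: p => [g|g s t /= t01].
  by exists 0%R; rewrite ?mem_head // lexx ler01.
by exists t; rewrite ?mem_head //; case/andP: t01 => /ltW -> /ltW ->.
Qed.

Lemma cell_ends_bounds p e : e \in cell_ends p ->
  (0 <= e.2)%R /\ (wd (cell_origin p) e.1 <= 1)%N.
Proof.
case: p => [g|g s t /= t01]; rewrite !inE.
  by move=> /eqP ->; rewrite word_dist_refl.
have [t0 t1] := andP t01.
move=> /orP[/eqP ->|/eqP ->] /=; first by rewrite word_dist_refl ltW.
split; first by rewrite subr_ge0 ltW.
apply/word_length_le; rewrite mulKg; apply: word_ball_letter.
exact: set_valP.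
Qed.

(** Each point is within 1 of the origin of its cell, which gives the upper bound. Below, every
    route through endpoints is at most 2 shorter than the distance of the origins, and for a route
    inside one edge the origins coincide. *)
Lemma cayley_dist_origin p q :
  (`|cayley_dist p q - (wd (cell_origin p) (cell_origin q))%:R| <= 2%:R)%R.
Proof.
set g := cell_origin p; set h := cell_origin q.
rewrite /cayley_dist; set A := (X in inf X).
have A_ge r : A r -> (0 <= r)%R /\ ((wd g h)%:R - 2%:R <= r)%R.
  case=> [|[a [b [ap bq ->]]]].
    rewrite /g /h; case: p q {A g h} => [?|g s t t01] [?|g' s' t' t01'] //=.
    move=> [-> _ ->]; rewrite word_dist_refl; split; first exact: normr_ge0.
    by apply: le_trans (normr_ge0 _); lra.
  have [a0 ga] := cell_ends_bounds ap; have [b0 hb] := cell_ends_bounds bq.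
  rewrite -/g in ga; rewrite -/h in hb; rewrite cayley_vertex_distE.
  have : (wd g h <= wd a.1 b.1 + 2)%N.
    have := word_dist_triangle S_gen g a.1 h.
    have := word_dist_triangle S_gen a.1 b.1 h.
    by rewrite (word_dist_sym S_inv S_gen b.1 h); lia.
  rewrite -(ler_nat Rdefinitions.R) natrD.
  have : (0 <= (wd a.1 b.1)%:R :> Rdefinitions.R)%R by exact: ler0n.
  by move: (_%:R)%R => x; split; lra.
have [t gt t01] := cell_ends_origin p; have [t' ht t01'] := cell_ends_origin q.
have Ax : A (t + (wd g h)%:R + t')%R.
  by right; exists (g, t), (h, t'); rewrite cayley_vertex_distE.
have le1 : (inf A <= t + (wd g h)%:R + t')%R.
  by apply: ge_inf Ax; exists 0%R => r /A_ge[].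
have le2 : ((wd g h)%:R - 2%:R <= inf A)%R.
  by apply: lb_le_inf => [|r /A_ge[] //]; exists (t + (wd g h)%:R + t')%R.
rewrite ler_norml; move: t01 t01' => /andP[? ?] /andP[? ?].
by apply/andP; split; lra.
Qed.

Lemma linear_area_hyperbolic K :
  finite_set S -> linear_area wd K -> hyperbolic_group G.
Proof.
move=> S_fin area; exists S; split=> //.
  apply/seteqP; split=> // a _; have [n] := S_gen a.
  exact: word_ball_generated.
(* Gromov products halve distances: [3 * (175 * K + 3)] is half the four-point error, and 6 covers
   half the cost of replacing four distances, each off by at most 2. *)
exists ((3 * (175 * K + 3))%:R + 6%:R)%R => w x y z.
have := @four_point _ _ (word_dist_refl S_gen) (word_dist_sym S_inv S_gen)
  (word_dist_triangle S_gen) (word_dist_geodesic S_gen) K area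
  (cell_origin w) (cell_origin x) (cell_origin y) (cell_origin z).
have -> : (6 * (175 * K + 3) = 3 * (175 * K + 3) + 3 * (175 * K + 3))%N by lia.
move: (3 * _)%N => C; rewrite -!(ler_nat Rdefinitions.R) !natrD.
have := cayley_dist_origin x w; have := cayley_dist_origin y w.
have := cayley_dist_origin z w; have := cayley_dist_origin x y.
have := cayley_dist_origin x z; have := cayley_dist_origin z y.
rewrite /gromov_product.
rewrite !ler_norml => /andP[? ?] /andP[? ?] /andP[? ?].
move=> /andP[? ?] /andP[? ?] /andP[? ?] four.
rewrite lerBlDr ge_min; apply/orP; case: four => ?; [left|right]; lra.
Qed.

End CayleyGraph.

Theorem corollary1p6 (G : groupType) (Lambda : Type)
    (H : Lambda -> groupClosed G) (Q : groupClosed G) :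
  relatively_hyperbolic H ->
  hyperbolically_embedded H Q ->
  hyperbolic_group (subgroup_type Q).
Proof.
move=> hypH embQ.
have [Y [Ygen [K [Yfin YV area]]]] := embedded_linear_area hypH embQ.
exact (linear_area_hyperbolic YV Yfin area).
Qed.
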